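(* Let $R$ be a finite commutative Frobenius ring, $P$ a probability on $R$ that is constant on associates, and $Q$ a probability on $R$. Let $\chi\in\widehat R$ be a generating character. Consider the pairs $(W,\rho)$ where $W=Rb$ is a principal ideal of $R$ (with a chosen generator $b$) and $\rho$ is a character of the multiplicative group $U(R/\mathrm{ann}(b))$. Then the eigenvalues, counted with multiplicity, of the transition matrix of the coin-toss walk on $R$ (with heads probability $\alpha$) are exactly the numbers \[\alpha\sum_{r\in R}P(r)\chi(br)+(1-\alpha)\sum_{r\in U(R)+\mathrm{ann}(b)}Q(r)\rho(r+\mathrm{ann}(b)),\] and those of the affine walk on $R$ are exactly the numbers \[\Big(\sum_{r\in R}P(r)\chi(br)\Big)\cdot\Big(\sum_{r\in U(R)+\mathrm{ann}(b)}Q(r)\rho(r+\mathrm{ann}(b))\Big),\] where $(W,\rho)$ ranges over all such pairs and each pair contributes exactly one eigenvalue (multiplicity one).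
   Context: Rings are unital. $U(R)$ denotes the unit group of $R$; $\mathrm{ann}(b)=\{r\in R: rb=0\}$. Elements $r_1,r_2\in R$ are associates if $r_1=ur_2$ with $u\in U(R)$; $P$ constant on associates means $P(ur)=P(r)$ for $u\in U(R)$. $\widehat R$ is the group of characters $\chi\colon (R,+)\to U(\mathbb C)$, an $R$-module via $(r\chi)(s)=\chi(rs)$. A finite ring $R$ is Frobenius if $R/J(R)$ is isomorphic to the socle of $R$ as a left and as a right module ($J(R)$ the Jacobson radical); for finite rings this is equivalent to $R\cong\widehat R$ as $R$-modules. A generating character is $\chi\in\widehat R$ such that $r\mapsto r\chi$ is an $R$-module isomorphism $R\to\widehat R$ (e.g. $\chi(m)=e^{2\pi i m/n}$ on $\mathbb Z/n\mathbb Z$). Walks on state space $R$ (viewed as a module over itself): the transition matrix has $(x,y)$-entry the probability of moving from $x$ to $y$. Coin-toss walk with heads probability $\alpha\in[0,1]$: from $x$, with probability $\alpha$ move to $x+b'$ with $b'$ chosen according to $P$, and with probability $1-\alpha$ move to $ax$ with $a$ chosen according to $Q$. Affine walk: choose independently $a$ according to $Q$ and $b'$ according to $P$ and move from $x$ to $ax+b'$. *)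

(* Defs.v *)
From HB Require Import structures.
From mathcomp Require Import all_boot all_order all_algebra all_fingroup.
From mathcomp Require Import generic_quotient ring_quotient cyclic.
From mathcomp Require Import complex reals.

Set Implicit Arguments.
Unset Strict Implicit.
Unset Printing Implicit Defensive.

Import Order.TTheory GRing.Theory Num.Theory.

Local Open Scope ring_scope.
Local Open Scope quotient_scope.
Local Open Scope complex_scope.

(* A finComPzRingType may be the zero ring. This is needed for quotients: when
   b = 0, the ring R / ann(b) is the zero ring, whose unit group is trivial. *)

Definition is_ideal (R : finComPzRingType) (I : {set R}) : bool :=
  [&& 0 \in I, [forall x in I, forall y in I, x + y \in I]
    & [forall r, forall x in I, r * x \in I]].

Record ideal (R : finComPzRingType) := Ideal {
  ideal_set :> {set R};
  _ : is_ideal ideal_set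
}.

HB.instance Definition _ (R : finComPzRingType) := [isSub for @ideal_set R].
HB.instance Definition _ (R : finComPzRingType) := [Finite of ideal R by <:].

Lemma is_idealP (R : finComPzRingType) (I : {set R}) :
  reflect [/\ 0 \in I, {in I &, forall x y, x + y \in I}
            & forall r, {in I, forall x, r * x \in I}]
          (is_ideal I).
Proof.
apply: (iffP and3P) => -[I0 ID IM]; split=> //.
- by move=> x y xI yI; move/forall_inP: ID => /(_ x xI)/forall_inP; apply.
- by move=> r x xI; move/forallP: IM => /(_ r)/forall_inP; apply.
- by apply/forall_inP=> x xI; apply/forall_inP=> y yI; apply: ID.
- by apply/forallP=> r; apply/forall_inP=> x xI; apply: IM.
Qed.

Lemma ideal0 (R : finComPzRingType) (I : ideal R) : 0 \in (I : {set R}).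
Proof. by case: I => I /= /is_idealP[]. Qed.

Lemma idealD (R : finComPzRingType) (I : ideal R) :
  {in (I : {set R}) &, forall x y, x + y \in (I : {set R})}.
Proof. by case: I => I /= /is_idealP[]. Qed.

Lemma idealM (R : finComPzRingType) (I : ideal R) (r : R) :
  {in (I : {set R}), forall x, r * x \in (I : {set R})}.
Proof. by case: I => I /= /is_idealP[_ _]; apply. Qed.

Definition ideal_pred (R : finComPzRingType) (I : ideal R) : {pred R} :=
  fun x => x \in (I : {set R}).

Lemma ideal_zmod_closed (R : finComPzRingType) (I : ideal R) :
  zmod_closed (ideal_pred I).
Proof.
split=> [|x y xI yI]; first exact: ideal0.
by rewrite -mulN1r; apply: idealD => //; apply: idealM.
Qed.

HB.instance Definition _ (R : finComPzRingType) (I : ideal R) :=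
  GRing.isZmodClosed.Build R (ideal_pred I) (ideal_zmod_closed I).

(* The library's additive quotient R / I; the library makes it a ring for
   proper ideals only, so the product is lifted here for every ideal. *)
Definition quo (R : finComPzRingType) (I : ideal R) : Type :=
  Quotient.quot (ideal_pred I).

HB.instance Definition _ (R : finComPzRingType) (I : ideal R) :=
  GRing.Zmodule.on (quo I).
HB.instance Definition _ (R : finComPzRingType) (I : ideal R) :=
  Quotient.on (quo I).
HB.instance Definition _ (R : finComPzRingType) (I : ideal R) :
  isCountable (quo I) := CanIsCountable (@reprK _ (quo I)).
HB.instance Definition _ (R : finComPzRingType) (I : ideal R) :
  isFinite (quo I) := CanIsFinite (@reprK _ (quo I)).

Definition cls (R : finComPzRingType) (I : ideal R) (r : R) : quo I :=
  \pi_(quo I) r.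

Section QuotientRing.
Variables (R : finComPzRingType) (I : ideal R).
Implicit Types (x y z : quo I) (r s : R).

Lemma cls_eq r s : (cls I r == cls I s) = (r - s \in (I : {set R})).
Proof. by rewrite [RHS](Quotient.idealrBE (ideal_pred I)). Qed.

Lemma clsK x : cls I (repr x) = x. Proof. exact: reprK. Qed.

Lemma clsD r s : cls I (r + s) = cls I r + cls I s.
Proof. exact: Quotient.pi_add. Qed.

Definition quo_one : quo I := cls I 1.
Definition quo_mul x y : quo I := cls I (repr x * repr y).

Lemma cls_mul r s : cls I (r * s) = quo_mul (cls I r) (cls I s).
Proof.
set r' := repr (cls I r); set s' := repr (cls I s).
have rI : r - r' \in (I : {set R}) by rewrite -cls_eq clsK.
have sI : s - s' \in (I : {set R}) by rewrite -cls_eq clsK.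
apply/eqP; rewrite cls_eq.
have -> : r * s - r' * s' = s * (r - r') + r' * (s - s').
  by rewrite !mulrBr addrA [s * r]mulrC [s * r']mulrC subrK.
by apply: idealD; apply: idealM.
Qed.

Lemma quo_mulA : associative quo_mul.
Proof.
by move=> x y z; rewrite -(clsK x) -(clsK y) -(clsK z) -!cls_mul mulrA.
Qed.

Lemma quo_mulC : commutative quo_mul.
Proof. by move=> x y; rewrite -(clsK x) -(clsK y) -!cls_mul mulrC. Qed.

Lemma quo_mul1 : left_id quo_one quo_mul.
Proof. by move=> x; rewrite -(clsK x) -cls_mul mul1r. Qed.

Lemma quo_mulDl : left_distributive quo_mul +%R.
Proof.
move=> x y z; rewrite -(clsK x) -(clsK y) -(clsK z).
by rewrite -clsD -!cls_mul -clsD mulrDl.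
Qed.

HB.instance Definition _ :=
  GRing.Zmodule_isComPzRing.Build (quo I) quo_mulA quo_mulC quo_mul1 quo_mulDl.

Lemma clsM r s : cls I (r * s) = cls I r * cls I s.
Proof. exact: cls_mul. Qed.

End QuotientRing.

Lemma principal_is_ideal (R : finComPzRingType) (b : R) :
  is_ideal [set r * b | r : R].
Proof.
apply/is_idealP; split=> [|_ _ /imsetP[r _ ->] /imsetP[s _ ->]|r].
- by apply/imsetP; exists 0; rewrite ?mul0r.
- by apply/imsetP; exists (r + s); rewrite ?mulrDl.
- by move=> _ /imsetP[s _ ->]; apply/imsetP; exists (r * s); rewrite ?mulrA.
Qed.

Definition principal_ideal (R : finComPzRingType) (b : R) : ideal R :=
  Ideal (principal_is_ideal b).

Definition is_principal (R : finComPzRingType) (W : ideal R) : bool :=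
  [exists b, W == principal_ideal b].

Lemma ann_is_ideal (R : finComPzRingType) (b : R) :
  is_ideal [set r | r * b == 0].
Proof.
apply/is_idealP; split=> [|x y|r x]; rewrite !inE ?mul0r //.
- by move=> /eqP xb /eqP yb; rewrite mulrDl xb yb addr0.
- by move=> /eqP xb; rewrite -mulrA xb mulr0.
Qed.

Definition ann (R : finComPzRingType) (b : R) : ideal R :=
  Ideal (ann_is_ideal b).

Definition maximal_ideal (R : finComPzRingType) (M : ideal R) : bool :=
  ((M : {set R}) \proper [set: R]) &&
  [forall I : ideal R,
     ((M : {set R}) \proper (I : {set R})) ==> ((I : {set R}) == [set: R])].

Definition minimal_ideal (R : finComPzRingType) (M : ideal R) : bool :=
  ([set 0] \proper (M : {set R})) &&
  [forall I : ideal R,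
     ((I : {set R}) \proper (M : {set R})) ==> ((I : {set R}) == [set 0])].

Lemma bigcap_is_ideal (R : finComPzRingType) (A : pred (ideal R)) :
  is_ideal (\bigcap_(I : ideal R | A I) (I : {set R})).
Proof.
apply/is_idealP; split=> [|x y /bigcapP xI /bigcapP yI|r x /bigcapP xI];
  apply/bigcapP=> I AI.
- exact: ideal0.
- by apply: idealD; [apply: xI | apply: yI].
- by apply: idealM; apply: xI.
Qed.

Definition jacobson (R : finComPzRingType) : ideal R :=
  Ideal (bigcap_is_ideal (@maximal_ideal R)).

(* The sum of the minimal ideals, i.e. the least ideal containing them all. *)
Definition socle (R : finComPzRingType) : ideal R :=
  Ideal (bigcap_is_ideal (fun I : ideal R =>
    [forall M : ideal R,
       minimal_ideal M ==> ((M : {set R}) \subset (I : {set R}))])).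

(* R / J(R) is isomorphic to the socle as an R-module, the action of R on
   R / J(R) being r . x = cls r * x. Left and right modules coincide as R is
   commutative. *)
Definition frobenius (R : finComPzRingType) : Prop :=
  exists f : quo (jacobson R) -> R,
    [/\ forall x y, f (x + y) = f x + f y,
        forall r x, f (cls (jacobson R) r * x) = r * f x,
        injective f
      & [set f x | x : quo (jacobson R)] = socle R].

Definition unit_pred (R : finComPzRingType) (x : R) : bool :=
  [exists y, x * y == 1].

Record units (R : finComPzRingType) := Units {
  units_val :> R;
  _ : unit_pred units_val
}.

HB.instance Definition _ (R : finComPzRingType) := [isSub for @units_val R].
HB.instance Definition _ (R : finComPzRingType) := [Finite of units R by <:].

Section UnitGroup.
Variable R : finComPzRingType.
Implicit Types u v w : units R.

Lemma units_one_subproof : unit_pred (1 : R).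
Proof. by apply/existsP; exists 1; rewrite mulr1. Qed.

Lemma units_mul_subproof u v : unit_pred (units_val u * units_val v).
Proof.
case: u v => [x /existsP[x' /eqP xx']] [y /existsP[y' /eqP yy']] /=.
by apply/existsP; exists (x' * y'); rewrite mulrACA xx' yy' mulr1.
Qed.

Lemma units_inv_ex u : exists y : R, units_val u * y == 1.
Proof. by case: u => x /= /existsP. Qed.

Lemma units_inv_subproof u : unit_pred (xchoose (units_inv_ex u)).
Proof.
apply/existsP; exists (units_val u); rewrite mulrC.
exact: (xchooseP (units_inv_ex u)).
Qed.

Definition units_one : units R := Units units_one_subproof.
Definition units_mul u v : units R := Units (units_mul_subproof u v).
Definition units_inv u : units R := Units (units_inv_subproof u).

Lemma units_mulA : associative units_mul.
Proof. by move=> u v w; apply/val_inj/mulrA. Qed.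

Lemma units_mul1 : left_id units_one units_mul.
Proof. by move=> u; apply/val_inj/mul1r. Qed.

Lemma units_mulV : left_inverse units_one units_inv units_mul.
Proof.
move=> u; apply/val_inj => /=; rewrite mulrC.
exact/eqP/(xchooseP (units_inv_ex u)).
Qed.

HB.instance Definition _ :=
  Finite_isGroup.Build (units R) units_mulA units_mul1 units_mulV.

End UnitGroup.

(* Homomorphisms from G to the multiplicative group of C; the conditions force
   the values to be nonzero. *)
Definition is_character (G : finGroupType) (C : closedFieldType)
    (rho : {ffun G -> C}) : bool :=
  (rho 1%g == 1) && [forall x, forall y, rho (x * y)%g == rho x * rho y].

Record character (G : finGroupType) (C : closedFieldType) := Character {
  char_fun :> {ffun G -> C};
  _ : is_character char_fun
}.

HB.instance Definition _ (G : finGroupType) (C : closedFieldType) :=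
  [isSub for @char_fun G C].
HB.instance Definition _ (G : finGroupType) (C : closedFieldType) :=
  [Choice of character G C by <:].

(* Finiteness of the set of characters: the values are roots of X^#|G| - 1. *)
Section CharacterFinite.
Variables (G : finGroupType) (C : closedFieldType).
Implicit Types rho : character G C.

Lemma char1 rho : rho 1%g = 1.
Proof. by case: rho => rho /= /andP[/eqP]. Qed.

Lemma charM rho x y : rho (x * y)%g = rho x * rho y.
Proof. by case: rho => rho /= /andP[_ /forallP/(_ x)/forallP/(_ y)/eqP]. Qed.

Definition unity_roots : seq C :=
  sval (closed_field_poly_normal ('X^#|G| - 1 : {poly C})).

Lemma char_unity_roots rho x : rho x \in unity_roots.
Proof.
rewrite /unity_roots; case: closed_field_poly_normal => s /= def_s.
have charX n : rho (x ^+ n)%g = rho x ^+ n.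
  by elim: n => [|n IHn]; rewrite ?expg0 ?char1 // expgS charM IHn exprS.
have nz : ('X^#|G| - 1 : {poly C}) != 0.
  have G_gt0 : (0 < #|G|)%N by apply/card_gt0P; exists 1%g.
  by rewrite -polyC1 monic_neq0 ?monicXnsubC.
have : root ('X^#|G| - 1) (rho x).
  by rewrite /root !hornerE -charX -cardsT expg_cardG ?in_setT // char1 subrr.
by rewrite def_s rootZ ?lead_coef_eq0 // root_prod_XsubC.
Qed.

Definition char_code rho : {ffun G -> seq_sub unity_roots} :=
  [ffun x => SeqSub (char_unity_roots rho x)].

Definition char_decode (f : {ffun G -> seq_sub unity_roots}) :
    option (character G C) :=
  insub [ffun x => ssval (f x)].

Lemma char_codeK : pcancel char_code char_decode.
Proof.
move=> rho; rewrite /char_decode.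
rewrite [X in insub X](_ : _ = char_fun rho) ?valK //.
by apply/ffunP => x; rewrite !ffunE.
Qed.

HB.instance Definition _ : isCountable (character G C) :=
  PCanIsCountable char_codeK.
HB.instance Definition _ : isFinite (character G C) :=
  PCanIsFinite char_codeK.

End CharacterFinite.

(* The library's finGroupType structure on the additive group (R, +). *)
Notation add_group R := (FinRing.Zmodule_to_finGroup R).

Lemma char_scale_subproof (R : finComPzRingType) (C : closedFieldType) (r : R)
    (chi : character (add_group R) C) :
  is_character ([ffun s : R => chi (r * s)] : {ffun add_group R -> C}).
Proof.
apply/andP; split; first by rewrite ffunE [r * _]mulr0 (char1 chi).
apply/forallP=> x; apply/forallP=> y.
by rewrite !ffunE [r * _]mulrDr (charM chi).
Qed.

Definition char_scale (R : finComPzRingType) (C : closedFieldType) (r : R)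
    (chi : character (add_group R) C) : character (add_group R) C :=
  Character (char_scale_subproof r chi).

(* The map r |-> r chi is an isomorphism of R-modules from R to the dual of
   (R, +), whose group law is pointwise multiplication. *)
Definition generating_character (R : finComPzRingType) (C : closedFieldType)
    (chi : character (add_group R) C) : Prop :=
  [/\ forall r r' s : R, char_scale (r + r') chi s =
                         char_scale r chi s * char_scale r' chi s,
      forall r r' : R, char_scale (r * r') chi =
                       char_scale r (char_scale r' chi)
    & bijective (fun r : R => char_scale r chi)].

(* The value of a character of U(S) at x : S. The second branch is a dummy value
   for non-units; it is never used below, see units_add_ann_unit. *)
Definition char_at (S : finComPzRingType) (C : closedFieldType)
    (rho : character (units S) C) (x : S) : C :=
  if insub x is Some u then rho u else 0.

Definition probability (K : realType) (R : finType) (P : R -> K) : Prop :=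
  (forall r, 0 <= P r) /\ \sum_(r : R) P r = 1.

Definition constant_on_associates (K : realType) (R : finComPzRingType)
    (P : R -> K) : Prop :=
  forall (u : units R) (r : R), P (units_val u * r) = P r.

(* The states are numbered by the library's enumeration of R. *)
Definition transition_mx (K : realType) (R : finType) (p : R -> R -> K) :
    'M[K[i]]_#|R| :=
  \matrix_(i, j) (p (enum_val i) (enum_val j))%:C.

Definition coin_toss_prob (K : realType) (R : finComPzRingType) (alpha : K)
    (P Q : R -> K) (x y : R) : K :=
  alpha * (\sum_(b : R | x + b == y) P b) +
  (1 - alpha) * (\sum_(a : R | a * x == y) Q a).

Definition affine_prob (K : realType) (R : finComPzRingType)
    (P Q : R -> K) (x y : R) : K :=
  \sum_(a : R) \sum_(b : R | a * x + b == y) Q a * P b.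

Definition units_add_ann (R : finComPzRingType) (b : R) : {set R} :=
  [set units_val u + z | u : units R, z : R in (ann b : {set R})].

Lemma units_add_ann_unit (R : finComPzRingType) (b r : R) :
  r \in units_add_ann b -> unit_pred (cls (ann b) r).
Proof.
case/imset2P => u z _ zb ->; have [v uv] := units_inv_ex u.
apply/existsP; exists (cls (ann b) v); rewrite -clsM cls_eq.
by rewrite mulrDl (eqP uv) addrC addKr mulrC idealM.
Qed.

Definition P_factor (K : realType) (R : finComPzRingType) (P : R -> K)
    (chi : character (add_group R) K[i]) (b : R) : K[i] :=
  \sum_(r : R) (P r)%:C * chi (b * r).

Definition Q_factor (K : realType) (R : finComPzRingType) (Q : R -> K) (b : R)
    (rho : character (units (quo (ann b))) K[i]) : K[i] :=
  \sum_(r in units_add_ann b) (Q r)%:C * char_at rho (cls (ann b) r).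

(* Main.v *)
Require Import Defs.
From mathcomp Require Import all_boot all_order all_algebra all_fingroup.
From mathcomp Require Import generic_quotient cyclic separable cyclotomic.
From mathcomp Require Import complex reals ring.

(** The functions x |-> chi (b x), for b in R, form a basis of the functions on
    R. In this basis both walks become matrices whose (c, b) entry is
    [c = b] beta(b) + gamma(b) sum_(a b = c) Q(a), with beta and gamma constant
    on associates. Such an entry vanishes unless Rc is contained in Rb, so the
    matrix is block triangular with one block for each principal ideal W = Rb.
    The generators of W are the elements u b for u in U(R / ann(b)), and the
    block of W is a scalar plus the convolution by the image of Q on this
    abelian group, which the characters of the group diagonalize. That beta and
    gamma are constant on generators of W, and that U(R) + ann(b) is the
    preimage of U(R / ann(b)), holds because units lift modulo an ideal of a
    finite commutative ring. *)

Set Implicit Arguments.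
Unset Strict Implicit.
Unset Printing Implicit Defensive.

Import GRing.Theory Num.Theory.

Local Open Scope ring_scope.
Local Open Scope complex_scope.

(** * Matrices indexed by finite types and their characteristic polynomials *)

Definition finmx (C : Type) (S T : finType) (f : S -> T -> C) :
    'M[C]_(#|S|, #|T|) :=
  \matrix_(i, j) f (enum_val i) (enum_val j).

(* A permutation s with r i <= r (s i) for all i preserves r, so only the
   identity contributes to the Leibniz expansion. *)
Lemma det_ranked (C : comNzRingType) n (r : 'I_n -> nat) (A : 'M[C]_n) :
  (forall i j, i != j -> A i j != 0 -> (r i < r j)%N) ->
  \det A = \prod_i A i i.
Proof.
move=> ltA; rewrite /determinant (bigD1 1%g) //= [X in _ + X]big1 ?addr0.
  by rewrite odd_perm1 mul1r; apply: eq_bigr => i _; rewrite perm1.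
move=> s s1; case: (boolP [exists i, A i (s i) == 0]).
  by case/existsP=> i /eqP Ai0; rewrite (bigD1 i) //= Ai0 mul0r mulr0.
rewrite negb_exists => /forallP nzA; case/eqP: s1.
have le_r i : (r i <= r (s i) ?= iff (s i == i))%N.
  apply/leqifP; case: (eqVneq (s i) i) => [->|sii]; first by rewrite eqxx.
  by apply: ltA; rewrite // eq_sym.
have := leqif_sum (fun i (_ : xpredT i) => le_r i) => -[_].
rewrite [X in X == _](reindex_inj (@perm_inj _ s)) eqxx => /esym/forallP si.
by apply/permP=> i; rewrite perm1; apply/eqP/si.
Qed.

Section FinMatrix.
Variable C : comNzRingType.
Implicit Types S T U : finType.

Lemma finmx_mul S T U (f : S -> T -> C) (g : T -> U -> C) :
  finmx f *m finmx g = finmx (fun x z => \sum_y f x y * g y z).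
Proof.
apply/matrixP=> i j; rewrite !mxE.
rewrite [RHS](reindex _ (onW_bij _ (@enum_val_bij T))) /=.
by apply: eq_bigr => k _; rewrite !mxE.
Qed.

Lemma finmx1 S : finmx (fun x y : S => (x == y)%:R) = 1%:M :> 'M[C]__.
Proof. by apply/matrixP=> i j; rewrite !mxE (inj_eq enum_val_inj). Qed.

Lemma eq_finmx S T (f g : S -> T -> C) : f =2 g -> finmx f = finmx g.
Proof. by move=> fg; apply/matrixP=> i j; rewrite !mxE fg. Qed.

(** The equality [m = n] is a hypothesis because the two bases may be indexed by different types of
    equal cardinality. *)
Lemma char_poly_conj m n (V : 'M[C]_(m, n)) (V' : 'M_(n, m)) (A : 'M_n) :
  m = n -> V *m V' = 1%:M -> char_poly (V *m A *m V') = char_poly A.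
Proof.
move=> eq_mn; case: n / eq_mn in V V' A * => VV'.
pose Vp := map_mx (@polyC C) V; pose V'p := map_mx (@polyC C) V'.
have VV'p : Vp *m V'p = 1%:M by rewrite -map_mxM VV' map_mx1.
have {1}-> : char_poly (V *m A *m V') = \det (Vp *m char_poly_mx A *m V'p).
  rewrite /char_poly /char_poly_mx mulmxBr mulmxBl -scalemx1 -scalemxAr mulmx1.
  by rewrite -scalemxAl VV'p scalemx1 !map_mxM.
by rewrite !det_mulmx mulrAC -det_mulmx VV'p det1 mul1r.
Qed.

Lemma char_poly_ranked n (r : 'I_n -> nat) (A : 'M[C]_n) :
  (forall i j, i != j -> A i j != 0 -> (r i < r j)%N) ->
  char_poly A = \prod_i ('X - (A i i)%:P).
Proof.
move=> ltA; rewrite /char_poly (det_ranked (r := r)) => [|i j neq_ij].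
  by apply: eq_bigr => i _; rewrite !mxE eqxx mulr1n.
rewrite !mxE (negPf neq_ij) mulr0n sub0r oppr_eq0 polyC_eq0.
exact: ltA.
Qed.

End FinMatrix.

(** The polynomial X^k - 1 annihilates [A] and is separable, since k is nonzero in [C]. *)
Lemma diagonalizable_of_order (C : closedFieldType) n (A : 'M[C]_n) k :
  k%:R != 0 :> C -> iter k (mulmx A) 1%:M = 1%:M -> diagonalizable A.
Proof.
case: n => [|n] in A *.
  by exists 1%:M; rewrite ?unitmx1 //; apply/is_diag_mxP; case.
move=> nz_k; have -> : iter k (mulmx A) 1%:M = A ^+ k.
  by elim: k {nz_k} => //= k ->; rewrite exprS.
move=> Ak1; apply/diagonalizableP.
have [s Ds] := closed_field_poly_normal ('X^k - 1 : {poly C}).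
have mon : 'X^k - 1 \is @monic C.
  by rewrite -polyC1 monicXnsubC //; case: k nz_k {Ak1 Ds} => // /eqP.
rewrite (monicP mon) scale1r in Ds.
exists s; first by rewrite -separable_prod_XsubC -Ds separable_Xn_sub_1.
rewrite -Ds; apply: mxminpoly_min.
by rewrite rmorphB rmorphXn rmorph1 /= horner_mx_X Ak1 subrr.
Qed.

(** * Characters of a finite abelian group *)

Section Characters.
Variables (G : finGroupType) (C : closedFieldType).
Implicit Types rho sigma : character G C.

Lemma charVM rho x : rho x^-1%g * rho x = 1.
Proof. by rewrite -Defs.charM mulVg Defs.char1. Qed.

(** Translation by [x] multiplies the sum by [rho x], so a nonzero sum forces [rho x = 1]. *)
Lemma sum_char rho : (\sum_x rho x == 0) || [forall x, rho x == 1].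
Proof.
rewrite -implyNb; apply/implyP=> nz; apply/forallP=> x.
apply/eqP/(mulIf nz); rewrite mul1r big_distrr /=.
rewrite [RHS](reindex_inj (mulgI x)); apply: eq_bigr => y _.
by rewrite Defs.charM.
Qed.

(** The quotient of [sigma] by [rho] is again a character, and [sum_char] applies to it. Over a
    general closed field [rho x^-1] replaces the complex conjugate. *)
Lemma char_orthogonality rho sigma :
  \sum_x rho x^-1%g * sigma x = (rho == sigma)%:R * #|G|%:R.
Proof.
case: eqP => [<-|neq]; rewrite ?mul1r ?mul0r.
  by under eq_bigr do rewrite charVM; rewrite sumr_const.
have chi_ok : is_character [ffun x => rho x^-1%g * sigma x].
  apply/andP; split; first by rewrite ffunE invg1 !Defs.char1 mulr1.
  apply/forallP=> x; apply/forallP=> y; apply/eqP.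
  rewrite !ffunE invMg !Defs.charM.
  by rewrite [rho y^-1%g * rho _]mulrC mulrACA.
case/orP: (sum_char (Character chi_ok)) => [/eqP|/forallP /= rs1].
  by move=> s0; rewrite -[RHS]s0; apply: eq_bigr => x _ /=; rewrite ffunE.
case: neq; apply/val_inj/ffunP=> x /=.
have:= rs1 x; rewrite ffunE => /eqP rs.
by rewrite -[sigma x]mul1r -(charVM rho x) mulrAC rs mul1r.
Qed.

Hypothesis nzG : #|G|%:R != 0 :> C.

(** By orthogonality the character table has a right inverse, so its rows are independent. *)
Lemma card_character_leq : (#|{: character G C}| <= #|G|)%N.
Proof.
pose V := finmx (fun (rho : character G C) (x : G) => rho x^-1%g).
pose V' := finmx (fun (x : G) (rho : character G C) => #|G|%:R^-1 * rho x).
apply: (@mulmx1_min _ _ _ V V'); rewrite finmx_mul -finmx1.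
apply: eq_finmx => rho sigma; under eq_bigr do rewrite mulrCA.
by rewrite -mulr_sumr char_orthogonality mulrCA mulVf ?mulr1.
Qed.

Hypothesis abelG : forall x y : G, (x * y = y * x)%g.

(** The right regular representation by permutation matrices. *)
Let reg (g : G) := finmx (fun x y : G => (x * g == y)%g%:R : C).

Let regM g h : reg g *m reg h = reg (g * h)%g.
Proof.
rewrite finmx_mul; apply: eq_finmx => x z.
rewrite (bigD1 (x * g)%g) //= eqxx mul1r mulgA big1 ?addr0 // => y.
by rewrite eq_sym => /negPf ->; rewrite mul0r.
Qed.

Let reg1 : reg 1%g = 1%:M.
Proof. by rewrite -finmx1; apply: eq_finmx => x y; rewrite mulg1. Qed.

Let regX g k : iter k (mulmx (reg g)) 1%:M = reg (g ^+ k)%g.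
Proof. by elim: k => [|k IHk]; rewrite /= ?reg1 // IHk regM expgS. Qed.

Let reg_diagonalizable g : diagonalizable (reg g).
Proof.
apply: (diagonalizable_of_order nzG).
have g1 : (g ^+ #|G| = 1)%g by rewrite -cardsT expg_cardG ?inE.
by rewrite regX g1 reg1.
Qed.

(** For the lower bound, the commuting matrices [reg g] are diagonalized simultaneously. Each
    diagonal coordinate is a character in [g], and distinct coordinates give distinct characters. *)
Lemma card_character : #|{: character G C}| = #|G|.
Proof.
apply/eqP; rewrite eqn_leq card_character_leq /=.
have [] : codiagonalizable [seq reg g | g : G].
  apply/codiagonalizableP; split=> [_ _ /mapP[g _ ->] /mapP[h _ ->]|].
    by rewrite /comm_mx !regM abelG.
  by move=> _ /mapP[g _ ->].
move=> P Pu /allP Pdiag.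
have {Pdiag} ex_d g : exists d, P *m reg g == diag_mx d *m P.
  have /Pdiag/diagonalizable_forPex[d /(simmxP Pu) Pd] :
      reg g \in [seq reg g | g : G].
    by rewrite map_f ?mem_enum.
  by exists d; apply/eqP.
pose d g := xchoose (ex_d g).
have Pd g : P *m reg g = diag_mx (d g) *m P by apply/eqP/(xchooseP (ex_d g)).
have P_inj (A B : 'M_#|G|) : A *m P = B *m P -> A = B.
  by move=> AB; rewrite -(mulmxK Pu A) AB mulmxK.
have d_char i : is_character [ffun g => d g 0 i].
  apply/andP; split.
    have /P_inj/matrixP/(_ i i): diag_mx (d 1%g) *m P = 1%:M *m P.
      by rewrite -Pd reg1 mulmx1 mul1mx.
    by rewrite !mxE ffunE eqxx !mulr1n => ->.
  apply/forallP=> g; apply/forallP=> h; apply/eqP; rewrite !ffunE.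
  have /P_inj/matrixP/(_ i i) :
      diag_mx (d (g * h)%g) *m P = diag_mx (d g) *m diag_mx (d h) *m P.
    by rewrite -Pd -regM mulmxA Pd -!mulmxA Pd.
  by rewrite mulmx_diag !mxE eqxx.
pose chr i : character G C := Character (d_char i).
suff chr_inj : injective chr.
  by rewrite -[X in (X <= _)%N]card_ord (leq_card _ chr_inj).
(* Evaluating P *m reg g at the column of 1 shows that, up to scaling, the
   i-th row of P is the character chr i; equal characters would make P
   singular. *)
have Prow i j : P i j = P i (enum_rank 1%g) * d (enum_val j)^-1%g 0 i.
  have /matrixP/(_ i (enum_rank 1%g)) := Pd (enum_val j)^-1%g.
  rewrite mul_diag_mx !mxE [RHS]mulrC => <-.
  rewrite (bigD1 j) //= !mxE enum_rankK.
  rewrite mulgV eqxx mulr1 big1 ?addr0 // => k; rewrite !mxE enum_rankK.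
  rewrite -(inj_eq enum_val_inj) -eq_mulgV1 => /negPf ->; exact: mulr0.
move=> i j eq_ij; apply/eqP/idPn=> neq_ij; case/idPn: Pu.
pose M := \matrix_(i, j) d (enum_val j)^-1%g 0 i : 'M[C]_#|G|.
have -> : P = diag_mx (\row_i P i (enum_rank 1%g)) *m M.
  by apply/matrixP=> k l; rewrite mul_diag_mx !mxE Prow.
rewrite unitmxE det_mulmx (@determinant_alternate _ _ M _ _ neq_ij).
  by rewrite mulr0 unitr0.
move=> k.
have /ffunP/(_ (enum_val k)^-1%g) : char_fun (chr i) = char_fun (chr j).
  by rewrite eq_ij.
by rewrite !ffunE !mxE.
Qed.

End Characters.

(** * Block triangular matrices whose diagonal blocks are group convolutions *)

Lemma sum_fibers (C : comNzRingType) (T S : finType) (t : T -> S) (a : T -> C)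
    (f : S -> C) :
  \sum_s (\sum_(u | t u == s) a u) * f s = \sum_u a u * f (t u).
Proof.
rewrite [RHS](partition_big t xpredT) //=; apply: eq_bigr => s _.
by rewrite mulr_suml; apply: eq_bigr => u /eqP->.
Qed.

Section BlockTriangular.
Variables (C : closedFieldType) (J S : finType) (G : J -> finGroupType).
Variable tau : forall j, G j -> S.
Hypothesis tau_bij :
  bijective (fun p : {j : J & G j} => tau (tagged p)).
Hypothesis nzG : forall j, #|G j|%:R != 0 :> C.
Hypothesis abelG : forall j (x y : G j), (x * y = y * x)%g.
Variables (D : S -> S -> C) (rk : J -> nat) (q : forall j, G j -> C).
Hypothesis D_diag :
  forall j (u v : G j), D (tau u) (tau v) = q (u * v^-1)%g.
Hypothesis D_off : forall j k (u : G j) (v : G k),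
  j != k -> D (tau u) (tau v) != 0 -> (rk j < rk k)%N.

Let I := {j : J & character (G j) C}.
(** The rows of [V] are the characters of all the groups, carried to [S] by [tau], extended by zero
    and normalized; [V'] is the inverse. As [tau] is injective, each sum has at most one term. *)
Let V (i : I) (s : S) : C :=
  #|G (tag i)|%:R^-1 * \sum_(u | tau u == s) tagged i u.
Let V' (s : S) (i : I) : C :=
  \sum_(u | tau u == s) tagged i u^-1%g.

Let card_I : #|{: I}| = #|S|.
Proof.
have <- : #|{: {j : J & G j}}| = #|S| by apply: bij_eq_card tau_bij.
rewrite !card_tagged; congr sumn; apply: eq_map => j.
exact: card_character.
Qed.

Let pairing (f : S -> S -> C) (i k : I) :
  \sum_t (\sum_s V i s * f s t) * V' t k =
  #|G (tag i)|%:R^-1 *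
  \sum_u \sum_v tagged i u * f (tau u) (tau v) * tagged k v^-1%g.
Proof.
have inner t : \sum_s V i s * f s t =
    #|G (tag i)|%:R^-1 * \sum_u tagged i u * f (tau u) t.
  rewrite -(sum_fibers (@tau (tag i)) (tagged i) (f^~ t)) mulr_sumr.
  by apply: eq_bigr => s _; rewrite mulrA.
under eq_bigr => t _ do rewrite inner -mulrA [X in _ * X]mulrC.
rewrite -mulr_sumr sum_fibers; congr (_ * _); rewrite exchange_big /=.
by apply: eq_bigr => v _; rewrite mulrC mulr_suml.
Qed.

(** Substituting [u * v] for [u] separates the variables: one factor is the orthogonality sum, the
    other the eigenvalue of the convolution by [a]. *)
Let orthogonal (j : J) (rho sigma : character (G j) C) (a : G j -> C) :
  #|G j|%:R^-1 * \sum_u \sum_v rho u * a (u * v^-1)%g * sigma v^-1%g =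
  (rho == sigma)%:R * \sum_g a g * rho g.
Proof.
rewrite exchange_big /=.
under eq_bigr => v _ do rewrite (reindex_inj (mulIg v)) /=.
transitivity (#|G j|%:R^-1 * ((\sum_v sigma v^-1%g * rho v) *
                              (\sum_g a g * rho g))).
  congr (_ * _); rewrite mulr_suml; apply: eq_bigr => v _.
  rewrite mulr_sumr; apply: eq_bigr => u _.
  by rewrite mulgK Defs.charM; ring.
by rewrite char_orthogonality eq_sym; field.
Qed.

Let tau_eq j (u v : G j) : (tau u == tau v) = (u == v).
Proof.
apply/eqP/eqP=> [uv|->//].
have : Tagged G u = Tagged G v by apply: (bij_inj tau_bij).
by move/eqP; rewrite -tag_eqE /tag_eq eqxx /= tagged_asE => /eqP.
Qed.

Let tau_neq j k (u : G j) (v : G k) : j != k -> (tau u == tau v) = false.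
Proof.
move=> neq_jk; apply: contraNF neq_jk => /eqP uv.
have : Tagged G u = Tagged G v by apply: (bij_inj tau_bij).
by move/(congr1 tag) => /= ->.
Qed.

Let VV' : finmx V *m finmx V' = 1%:M.
Proof.
rewrite finmx_mul -finmx1; apply: eq_finmx => i k.
(* Inserting the identity kernel gives the product the shape of [pairing]; on each block this kernel
   is the convolution by the delta function at 1. *)
have VE t : V i t = \sum_s V i s * (s == t)%:R.
  rewrite (bigD1 t) //= eqxx mulr1 big1 ?addr0 // => s /negPf->.
  exact: mulr0.
under eq_bigr => t _ do rewrite VE.
rewrite pairing; case: i k {VE} => [j rho] [k sigma] /=.
case: (eqVneq j k) => [jk|neq_jk].
  case: k / jk in sigma *.
  have sum1 : \sum_g (g == 1%g)%:R * rho g = 1.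
    rewrite (bigD1 1%g) //= eqxx Defs.char1 mulr1 big1 ?addr0 // => g /negPf->.
    exact: mul0r.
  have := orthogonal rho sigma (fun g => (g == 1%g)%:R); rewrite sum1 mulr1.
  rewrite -tag_eqE /tag_eq eqxx /= tagged_asE => <-; congr (_ * _).
  apply: eq_bigr => u _; apply: eq_bigr => v _.
  by rewrite tau_eq eq_mulgV1.
rewrite -tag_eqE /tag_eq (negPf neq_jk) /= big1 ?mulr0 // => u _.
by rewrite big1 // => v _; rewrite tau_neq // mulr0 mul0r.
Qed.

(** Conjugation by [V] diagonalizes every diagonal block, and the other nonzero entries strictly
    raise [rk], so the eigenvalues stand on the diagonal. *)
Lemma char_poly_block_convolution :
  char_poly (finmx D) =
  \prod_j \prod_(rho : character (G j) C) ('X - (\sum_g q g * rho g)%:P).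
Proof.
rewrite -(char_poly_conj (finmx D) card_I VV') !finmx_mul.
rewrite (eq_finmx (pairing D)).
rewrite (char_poly_ranked (r := fun i => rk (tag (enum_val i : I)))).
  rewrite sig_big_dep /= [RHS](reindex _ (onW_bij _ (@enum_val_bij I))) /=.
  apply: eq_bigr => i _; rewrite mxE; case: (enum_val i) => j rho /=.
  under eq_bigr => u _ do under eq_bigr => v _ do rewrite D_diag.
  by rewrite orthogonal eqxx mul1r.
move=> i k; rewrite -(inj_eq enum_val_inj) mxE.
case: (enum_val i) (enum_val k) => [j rho] [l sigma] /=.
case: (eqVneq j l) => [jl|neq_jl _ nz].
  case: l / jl in sigma *; rewrite -tag_eqE /tag_eq eqxx /= tagged_asE => neq.
  under eq_bigr => u _ do under eq_bigr => v _ do rewrite D_diag.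
  by rewrite orthogonal (negPf neq) mul0r eqxx.
apply: contraR nz => le_rk.
rewrite big1 ?mulr0 // => u _; rewrite big1 // => v _.
suff /eqP-> : D (tau u) (tau v) == 0 by rewrite mulr0 mul0r.
by apply: contraR le_rk; apply: D_off.
Qed.

End BlockTriangular.

(** * Lifting units modulo an ideal, and generators of principal ideals *)

Section UnitLifting.
Variable R : finComPzRingType.
Implicit Types (I W : ideal R) (r b : R).

(** By the pigeonhole principle the powers of [r] are eventually periodic. *)
Lemma idempotent_power r : exists n, r ^+ n.+1 * r ^+ n.+1 = r ^+ n.+1.
Proof.
have [i [p [p_gt0 per]]] : exists i p, (0 < p)%N /\ r ^+ (i + p) = r ^+ i.
  have /injectivePn : ~~ injectiveb (fun k : 'I_#|R|.+1 => r ^+ k).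
    by apply/injectiveP=> /leq_card; rewrite card_ord ltnn.
  case=> i [j neq_ij eq_ij]; wlog lt_ij : i j neq_ij eq_ij / (i < j)%N.
    move=> IH; have := neq_ij; rewrite neq_ltn => /orP[] lt_ij.
      exact: IH lt_ij.
    by apply: IH lt_ij; rewrite // eq_sym.
  by exists i, (j - i)%N; rewrite subn_gt0 lt_ij subnKC // ltnW.
have perM m k : (i <= k)%N -> r ^+ (k + m * p) = r ^+ k.
  move=> le_ik; elim: m => [|m IHm]; first by rewrite addn0.
  rewrite -{}IHm mulSnr addnA; move: (leq_trans le_ik (leq_addr (m * p) k)).
  by move: (k + _)%N => l /subnK<-; rewrite -addnA exprD per -exprD.
(* The exponent [i.+1 * p] is a multiple of the period, at least [i], and positive even for
   [i = 0]. *)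
exists (i.+1 * p).-1; rewrite prednK ?muln_gt0 // -exprD perM //.
by rewrite (leq_trans (leqnSn i)) ?leq_pmulr.
Qed.

Lemma clsX I r n : cls I (r ^+ n) = cls I r ^+ n.
Proof. by elim: n => [|n IHn]; rewrite ?expr0 // !exprS clsM IHn. Qed.

Lemma cls_unitP I r :
  reflect (exists u : units R, cls I (units_val u) = cls I r)
          (unit_pred (cls I r)).
Proof.
apply: (iffP idP) => [/existsP[y /eqP ry1]|[u <-]]; last first.
  have [v /eqP uv] := units_inv_ex u.
  by apply/existsP; exists (cls I v); rewrite -clsM uv.
(* With e an idempotent power of r, the element r e + (1 - e) is a unit; it is
   congruent to r because e, being idempotent and a unit modulo I, is
   congruent to 1. *)
have [n ee] := idempotent_power r; set e := r ^+ n.+1 in ee.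
have e1 : cls I e = 1.
  have inv : cls I e * y ^+ n.+1 = 1 by rewrite clsX -exprMn ry1 expr1n.
  by rewrite -[LHS]mulr1 -inv mulrA -clsM ee.
have e0 : e * (1 - e) = 0 by rewrite mulrBr mulr1 ee subrr.
have u_unit : unit_pred (r * e + (1 - e)).
  have ef1 : e + (1 - e) = 1 by rewrite addrC subrK.
  move: (1 - e) e0 ef1 => f e0 ef1.
  have ff : f * f = f by rewrite -[RHS]mul1r -ef1 mulrDl e0 add0r.
  (* As [r * r ^+ n = e], the factor [r ^+ n] inverts [r] on the component of [e]; on that of [f]
     both elements are 1. *)
  apply/existsP; exists (r ^+ n * e + f); apply/eqP.
  rewrite mulrDl !mulrDr mulrACA -exprS -/e ee ee -mulrA e0 mulr0 addr0.
  by rewrite mulrCA [f * e]mulrC e0 mulr0 add0r ff.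
exists (Units u_unit) => /=; apply: (addIr (cls I e)).
by rewrite -clsD -addrA subrK clsD clsM e1 mulr1.
Qed.

Lemma cls_ann_eq b r s : (cls (ann b) r == cls (ann b) s) = (r * b == s * b).
Proof. by rewrite cls_eq inE mulrBl subr_eq0. Qed.

Lemma mem_units_add_ann b r :
  (r \in units_add_ann b) = unit_pred (cls (ann b) r).
Proof.
apply/idP/idP=> [/units_add_ann_unit//|/cls_unitP[u /esym/eqP]].
rewrite cls_eq => ru; apply/imset2P; exists u (r - units_val u) => //.
by rewrite addrC subrK.
Qed.

Lemma principal_idealP b c :
  reflect (exists r s, c = r * b /\ b = s * c)
          (principal_ideal c == principal_ideal b).
Proof.
have memP x y :
    reflect (exists r, x = r * y) (x \in (principal_ideal y : {set R})).
  by apply: (iffP imsetP) => [[r _ ->]|[r ->]]; exists r.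
have mem_id x : x \in (principal_ideal x : {set R}).
  by apply/memP; exists 1; rewrite mul1r.
apply: (iffP eqP) => [eq_cb|[r [s [cE bE]]]].
  have /memP[r cE] : c \in (principal_ideal b : {set R}) by rewrite -eq_cb.
  have /memP[s bE] : b \in (principal_ideal c : {set R}) by rewrite eq_cb.
  by exists r, s.
apply/val_inj/setP=> x; apply/memP/memP=> -[t ->].
  by exists (t * r); rewrite -mulrA -cE.
by exists (t * s); rewrite -mulrA -bE.
Qed.

End UnitLifting.

(** If [c = r * b] and [b = s * c], then [r] is a unit modulo [ann b], with inverse [s]; a lift of
    it to a unit has the same product with [b]. *)
Lemma principal_ideal_associate (R : finComPzRingType) (b c : R) :
  principal_ideal c = principal_ideal b ->
  exists u : units R, c = units_val u * b.
Proof.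
move=> /eqP/principal_idealP[r [s [cE bE]]].
have /cls_unitP[u /eqP] : unit_pred (cls (ann b) r).
  apply/existsP; exists (cls (ann b) s); rewrite -clsM cls_ann_eq mul1r.
  by rewrite [r * s]mulrC -mulrA -cE -bE.
by rewrite cls_ann_eq => /eqP ub; exists u; rewrite cE ub.
Qed.

Lemma sum_char_at (S : finComPzRingType) (C : closedFieldType) (T : finType)
    (rho : character (units S) C) (t : T -> S) (a : T -> C) :
  \sum_g (\sum_(r | t r == units_val g) a r) * rho g =
  \sum_(r | unit_pred (t r)) a r * char_at rho (t r).
Proof.
under eq_bigr do rewrite mulr_suml.
rewrite (exchange_big_dep (fun r => unit_pred (t r))) /=.
  apply: eq_bigr => r ur; rewrite (big_pred1 (Units ur)) => [|g]; last first.
    by rewrite eq_sym.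
  by rewrite /char_at insubT.
by move=> [g ug] r _ /eqP->.
Qed.

(** * The matrix of the walks in the basis of characters *)

Section MultiplicationWalk.
Variables (K : realType) (R : finComPzRingType) (Q : R -> K).
Variables (gen : ideal R -> R).
Hypothesis genP :
  forall W : ideal R, is_principal W -> W = principal_ideal (gen W).
Variables (beta gamma : R -> K[i]).
Hypothesis beta_assoc :
  forall (u : units R) b, beta (units_val u * b) = beta b.
Hypothesis gamma_assoc :
  forall (u : units R) b, gamma (units_val u * b) = gamma b.

(** A common form of both walks: [gamma] is constant for the coin-toss walk, and [beta] is zero for
    the affine walk. *)
Definition mult_coef (c b : R) : K[i] :=
  (c == b)%:R * beta b + gamma b * \sum_(a | a * b == c) (Q a)%:C.

Let J := {W : ideal R | is_principal W}.
Let G (j : J) : finGroupType := units (quo (ann (gen (val j)))).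
(** The value does not depend on the representative, since the class is taken modulo the annihilator
    of the generator. *)
Let tau (j : J) (u : G j) : R := repr (units_val u) * gen (val j).

Let tau_principal (j : J) (u : G j) : principal_ideal (tau u) = val j.
Proof.
rewrite [RHS]genP; last by case: (j).
apply/eqP/principal_idealP; exists (repr (units_val u)).
have [v /eqP uv] := units_inv_ex u; exists (repr v); split=> //.
apply/eqP; rewrite mulrA mulrC -[X in X == _]mul1r eq_sym.
by rewrite [_ * (_ * _)]mulrC -cls_ann_eq clsM !clsK mulrC uv.
Qed.

Let tau_eq (j : J) (u : G j) a :
  (a * gen (val j) == tau u) = (cls _ a == units_val u).
Proof. by rewrite -[X in _ = (_ == X)]clsK cls_ann_eq. Qed.

Let tau_bij : bijective (fun p : {j : J & G j} => tau (tagged p)).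
Proof.
pose f (p : {j : J & G j}) := tau (tagged p).
rewrite -[X in bijective X]/f; have f_inj : injective f.
  case=> [j u] [k v] /= uv.
  have jk : j = k.
    by apply: val_inj; rewrite -(tau_principal u) [tau u]uv tau_principal.
  case: k / jk in v uv *; congr Tagged; apply/val_inj/eqP => /=.
  by rewrite -[units_val u]clsK -tau_eq; apply/eqP.
have f_surj c : exists p, f p == c.
  have pc : is_principal (principal_ideal c) by apply/existsP; exists c.
  have /eqP/principal_idealP[r [s [cE bE]]] := genP pc.
  have ur : unit_pred (cls (ann (gen (principal_ideal c))) r).
    apply/existsP; exists (cls (ann (gen (principal_ideal c))) s).
    by rewrite -clsM cls_ann_eq mul1r [r * s]mulrC -mulrA -cE -bE.
  pose j : J := exist (fun W : ideal R => is_principal W) _ pc.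
  exists (Tagged G (Units ur : G j)); rewrite /f /= eq_sym.
  rewrite [X in X == _]cE; apply: etrans (tau_eq (Units ur : G j) r) _.
  exact: eqxx.
have gK : cancel (fun c => xchoose (f_surj c)) f.
  by move=> c; apply/eqP/(xchooseP (f_surj c)).
by exists (fun c => xchoose (f_surj c)); first exact: inj_can_sym f_inj.
Qed.

(** Replaces a unit of the quotient by a unit of [R], the only kind under which [beta] and [gamma]
    are assumed invariant. *)
Let tau_assoc (j : J) (v : G j) :
  exists u : units R, tau v = units_val u * gen (val j).
Proof.
apply: principal_ideal_associate.
by rewrite tau_principal [LHS]genP //; case: (j).
Qed.

Lemma char_poly_mult_coef :
  char_poly (finmx mult_coef) =
  \prod_(W : ideal R | is_principal W)
    \prod_(rho : character (units (quo (ann (gen W)))) K[i])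
      ('X - (beta (gen W) + gamma (gen W) * Q_factor Q rho)%:P).
Proof.
(* The convolution kernel of a block: a scalar at 1 plus the image of [Q] on the unit group. Blocks
   are ranked by the cardinality of their ideals. *)
pose q (j : J) (g : G j) : K[i] := (g == 1%g)%:R * beta (gen (val j)) +
  gamma (gen (val j)) * \sum_(a | cls _ a == units_val g) (Q a)%:C.
rewrite (@char_poly_block_convolution _ _ _ G tau tau_bij _ _ _
           (fun j => #|(val j : {set R})|) q).
- rewrite [RHS]big_sub /=; apply: eq_bigr => j _; apply: eq_bigr => rho _.
  congr ('X - _%:P).
  under eq_bigr do rewrite mulrDl; rewrite big_split /=; congr (_ + _).
    rewrite (bigD1 1%g) //= eqxx mul1r Defs.char1 mulr1 big1 ?addr0 //.
    by move=> g /negPf->; rewrite !mul0r.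
  under eq_bigr do rewrite -mulrA.
  rewrite -mulr_sumr (sum_char_at rho (cls _) (fun a => (Q a)%:C)).
  by congr (_ * _); apply: eq_bigl => r; rewrite mem_units_add_ann.
- by move=> j; rewrite pnatr_eq0 -lt0n; apply/card_gt0P; exists 1%g.
- by move=> j x y; apply/val_inj/mulrC.
- move=> j u v; rewrite /mult_coef /q {1}/tau tau_eq clsK -eq_mulgV1.
  have [w vE] := tau_assoc v; rewrite {1 2}vE beta_assoc gamma_assoc.
  congr (_ + _ * _); apply: eq_bigl => a.
  rewrite {1}/tau mulrA tau_eq clsM clsK.
  have vV : units_val v * units_val v^-1%g = 1.
    by rewrite -[LHS]/(units_val (v * v^-1)%g) mulgV.
  rewrite -[X in _ = (_ == X)]/(units_val u * units_val v^-1%g).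
  apply/eqP/eqP=> [<-|->]; first by rewrite -mulrA vV mulr1.
  by rewrite -mulrA [_ * units_val v]mulrC vV mulr1.
move=> j k u v neq_jk nz.
have neq_uv : principal_ideal (tau u) != principal_ideal (tau v).
  by rewrite !tau_principal (inj_eq val_inj).
(* Between different blocks only the term in [Q] can be nonzero, which makes [tau u] a multiple of
   [tau v], with a strictly smaller ideal. *)
have /existsP[a /eqP av] : [exists a, a * tau v == tau u].
  apply: contraR nz; rewrite negb_exists => /forallP no_a.
  rewrite /mult_coef big1 => [|a]; last by rewrite (negPf (no_a a)).
  have /negPf-> : tau u != tau v by apply: contraNneq neq_uv => ->.
  by rewrite mul0r mulr0 addr0.
rewrite -(tau_principal u) -(tau_principal v) proper_card // properEneq.
rewrite (inj_eq val_inj) neq_uv; apply/subsetP=> _ /imsetP[r _ ->].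
by apply/imsetP; exists (r * a); rewrite // -av mulrA.
Qed.

End MultiplicationWalk.

(** * The Fourier transform of the two walks *)

Section FourierTransform.
Variables (K : realType) (R : finComPzRingType).
Variable chi : character (add_group R) K[i].
Hypothesis genchi : generating_character chi.

Lemma char_addM x y : chi (x + y : R) = chi x * chi y.
Proof. exact: (Defs.charM chi). Qed.

(** The hypothesis says that the Fourier matrix [F] intertwines the walk with [D]. It is invertible
    by orthogonality, as distinct [b] give distinct characters [char_scale b chi]. *)
Lemma char_poly_fourier (p : R -> R -> K) (D : R -> R -> K[i]) :
  (forall x b, \sum_y (p x y)%:C * chi (b * y) = \sum_c chi (c * x) * D c b) ->
  char_poly (transition_mx p) = char_poly (finmx D).
Proof.
move=> pD; have [_ _ bij_chi] := genchi.
pose F (x b : R) : K[i] := chi (b * x).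
pose F' (b x : R) : K[i] := #|R|%:R^-1 * chi (b * - x).
have F'F : finmx F' *m finmx F = 1%:M.
  rewrite finmx_mul -finmx1; apply: eq_finmx => b c.
  have := char_orthogonality (char_scale b chi) (char_scale c chi).
  rewrite (inj_eq (bij_inj bij_chi)) => orth.
  have nzR : #|R|%:R != 0 :> K[i].
    by rewrite pnatr_eq0 -lt0n; apply/card_gt0P; exists 0.
  rewrite -[RHS](mulfK nzR) -[in RHS]orth mulrC mulr_sumr.
  by apply: eq_bigr => x _; rewrite !ffunE mulrA.
rewrite -(char_poly_conj _ erefl F'F).
rewrite -[transition_mx p]/(finmx (fun x y => (p x y)%:C)).
by rewrite -mulmxA finmx_mul (eq_finmx pD) -finmx_mul mulmxA F'F mul1mx.
Qed.

Lemma mult_coef_fourier (Q : R -> K) (beta gamma : R -> K[i]) x b :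
  \sum_c chi (c * x) * mult_coef Q beta gamma c b =
  beta b * chi (b * x) + gamma b * \sum_a (Q a)%:C * chi (a * b * x).
Proof.
rewrite -(sum_fibers (fun a => a * b) (fun a => (Q a)%:C)
                     (fun c => chi (c * x))).
under eq_bigr do rewrite mulrDr; rewrite big_split /= mulr_sumr; congr (_ + _).
  rewrite (bigD1 b) //= eqxx mul1r big1 ?addr0 1?mulrC // => c /negPf->.
  by rewrite mul0r mulr0.
by apply: eq_bigr => c _; rewrite mulrCA [chi _ * _]mulrC.
Qed.

Variables P Q : R -> K.
Hypothesis assocP : constant_on_associates P.

Lemma P_factor_associate (u : units R) b :
  P_factor P chi (units_val u * b) = P_factor P chi b.
Proof.
have u_inj : injective (fun r : R => units_val u * r).
  have [v /eqP uv] := units_inv_ex u => r s /(congr1 ( *%R v)).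
  by rewrite !mulrA [v * _]mulrC uv !mul1r.
rewrite /P_factor [RHS](reindex_inj u_inj); apply: eq_bigr => r _ /=.
by rewrite assocP mulrCA mulrA.
Qed.

(** Adding r to the state multiplies [chi (b * x)] by [chi (b * r)], while multiplying the state by
    a replaces the index [b] by [a * b]. *)
Lemma coin_toss_fourier alpha x b :
  \sum_y (coin_toss_prob alpha P Q x y)%:C * chi (b * y) =
  \sum_c chi (c * x) * mult_coef Q (fun b => alpha%:C * P_factor P chi b)
                                   (fun=> (1 - alpha)%:C) c b.
Proof.
rewrite mult_coef_fourier.
under eq_bigr => y _ do
  rewrite rmorphD /= !rmorphM /= !rmorph_sum /= mulrDl -!mulrA.
rewrite big_split /= -!mulr_sumr.
rewrite (sum_fibers (fun r => x + r) (fun r => (P r)%:C)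
                    (fun y => chi (b * y))).
rewrite (sum_fibers (fun a => a * x) (fun a => (Q a)%:C)
                    (fun y => chi (b * y))).
congr (_ + _ * _); last by apply: eq_bigr => a _; rewrite mulrA [b * a]mulrC.
rewrite -mulrA mulr_suml; congr (_ * _); apply: eq_bigr => r _.
by rewrite mulrDr char_addM mulrCA mulrC.
Qed.

(** The added term is independent of the multiplier, so [P_factor] comes out of the sum over
    multipliers. *)
Lemma affine_fourier x b :
  \sum_y (affine_prob P Q x y)%:C * chi (b * y) =
  \sum_c chi (c * x) * mult_coef Q (fun=> 0) (P_factor P chi) c b.
Proof.
rewrite mult_coef_fourier mul0r add0r.
under eq_bigr => y _ do rewrite rmorph_sum mulr_suml.
rewrite exchange_big mulr_sumr /=; apply: eq_bigr => a _.
under eq_bigr => y _ do rewrite rmorph_sum /=.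
rewrite (sum_fibers (fun r => a * x + r) (fun r => (Q a * P r)%:C)
                    (fun y => chi (b * y))).
rewrite mulr_suml; apply: eq_bigr => r _.
by rewrite mulrDr char_addM [b * (a * x)]mulrA [b * a]mulrC rmorphM /=; ring.
Qed.

End FourierTransform.

Theorem theorem1p4 (K : realType) (R : finComPzRingType) (frobR : frobenius R)
    (P Q : R -> K) (probP : probability P) (assocP : constant_on_associates P)
    (probQ : probability Q) (alpha : K) (alpha01 : 0 <= alpha <= 1)
    (chi : character (add_group R) K[i]) (genchi : generating_character chi)
    (gen : ideal R -> R)
    (genP : forall W : ideal R, is_principal W -> W = principal_ideal (gen W)) :
  char_poly (transition_mx (coin_toss_prob alpha P Q)) =
    \prod_(W : ideal R | is_principal W)
      \prod_(rho : character (units (quo (ann (gen W)))) K[i])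
        ('X - (alpha%:C * P_factor P chi (gen W) +
               (1 - alpha)%:C * Q_factor Q rho)%:P)
  /\
  char_poly (transition_mx (affine_prob P Q)) =
    \prod_(W : ideal R | is_principal W)
      \prod_(rho : character (units (quo (ann (gen W)))) K[i])
        ('X - (P_factor P chi (gen W) * Q_factor Q rho)%:P).
Proof.
have PfA := P_factor_associate chi assocP; split.
  rewrite (char_poly_fourier genchi (coin_toss_fourier chi P Q alpha)).
  by rewrite (char_poly_mult_coef _ genP) // => u b; rewrite PfA.
rewrite (char_poly_fourier genchi (affine_fourier chi P Q)).
rewrite (char_poly_mult_coef _ genP) //.
by apply: eq_bigr => W _; apply: eq_bigr => rho _; rewrite add0r.
Qed.
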